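(* Let $\mathcal{H}$ and $\mathcal{G}$ be categories, let $I:\mathcal{H}\to\mathcal{G}$, $R:\mathcal{G}\to\mathcal{H}$ and $F:\mathcal{H}\to\mathcal{H}$ be functors, and let $\mathcal{X}\subseteq\mathcal{L}$ be full subcategories of $\mathcal{H}$. Put $\mathcal{M}=\mathcal{A}d(I(\mathcal{L}))\subseteq\mathcal{G}$, $\mathcal{Y}=\mathcal{X}+\mathcal{A}d(F(\mathcal{L}))\subseteq\mathcal{H}$ and $\mathcal{L}'=\mathcal{L}+\mathcal{A}d(F(\mathcal{L}))\subseteq\mathcal{H}$. Assume: (1) All of these categories are additive. (2) $\mathcal{L}$ and $\mathcal{X}$ are closed under direct sums and direct summands in $\mathcal{H}$. (3) The quotient categories $\mathcal{H}/\mathcal{X}$ and $\mathcal{G}/I(\mathcal{X})$ are defined. (4) $I$ and $R$ are an adjoint pair of functors with natural transformations $\varepsilon:1_{\mathcal{H}}\to RI$ and $\eta:IR\to 1_{\mathcal{G}}$ (unit and counit). (5) There is a natural transformation $\varphi:F\to RI$ such that $(\varepsilon,\varphi):1_{\mathcal{H}}\oplus F\to RI$ is an isomorphism of functors. In particular $RI(M)\cong M\oplus F(M)$ for every object $M$ of $\mathcal{H}$. (6) For all objects $L$ and $M$ in $\mathcal{L}$, every map $\gamma:L\to F(M)$ and every map $\delta:F(M)\to L$ that factors through an object in $\mathcal{Y}$ factors also through an object in $\mathcal{X}$. (7) The quotient category $\mathcal{H}/\mathcal{X}$ has idempotent completions, i.e. every idempotent endomorphism in it splits. Then there is an adjoint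 pair of functors $$\mathbb{I}:\mathcal{L}/\mathcal{X}\to\mathcal{M}/I(\mathcal{X}),\qquad \mathbb{R}:\mathcal{M}/I(\mathcal{X})\to\mathcal{L}/\mathcal{X}$$ that give equivalences of categories.
   Context: For a subcategory $\mathcal{D}$, $\mathcal{A}d(\mathcal{D})$ is its closure under taking direct summands (in the ambient category). For subcategories $\mathcal{C},\mathcal{D}$ of an additive category, $\mathcal{C}+\mathcal{D}$ is the full subcategory of all objects that can be written as a direct sum of an object of $\mathcal{C}$ and an object of $\mathcal{D}$. If $\mathcal{D}$ is a subcategory of an additive category $\mathcal{C}$, the quotient $\mathcal{C}/\mathcal{D}$ has the same objects as $\mathcal{C}$, and its morphisms are those of $\mathcal{C}$ modulo the morphisms that factor through an object of $\mathcal{D}$. An idempotent $e:X\to X$ splits if $X=X'\oplus X''$ in such a way that $e$ is the identity on $X'$ and zero on $X''$. The functor $\mathbb{I}$ is the functor induced by the restriction of $I$ to $\mathcal{L}$. The functor $\mathbb{R}$ is the one induced by $R$, as follows: for $M$ in $\mathcal{M}$ there are objects $Y,Y'$ of $\mathcal{Y}$ and $L'$ of $\mathcal{L}$ with $R(M)\oplus Y\cong L'\oplus Y'$ in $\mathcal{H}$, and $\mathbb{R}(M)=L'$.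
   Formalization: ''Direct summand'' is read as retract (no complement required), since otherwise the claim fails when H is not idempotent complete; R(M)⊕Y≅L'⊕Y' is asserted for L'=ℝ(M) only when some such L' in L exists, and in general only a natural isomorphism R(M)≅ℝ(M) in H/Y. *)

(* Defs.v *)
(* Classical logic (boolp) is used to decide whether a morphism factors. *)
From HB Require Import structures.
From mathcomp Require Import all_boot ssralg generic_quotient ring_quotient.
From mathcomp Require Import boolp.

Set Implicit Arguments.
Unset Strict Implicit.
Unset Printing Implicit Defensive.

Import GRing.Theory.
Local Open Scope ring_scope.
Local Open Scope quotient_scope.

Declare Scope cat_scope.
Delimit Scope cat_scope with cat.
Local Open Scope cat_scope.

Reserved Notation "g \oc f" (at level 40, left associativity).
Reserved Notation "T \of U" (at level 40, left associativity).

Record preadditive := Preadditive {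
  obj :> Type;
  hom : obj -> obj -> zmodType;
  idm : forall A, hom A A;
  compm : forall A B C, hom B C -> hom A B -> hom A C;
  compA : forall A B C D (h : hom C D) (g : hom B C) (f : hom A B),
    compm h (compm g f) = compm (compm h g) f;
  comp1m : forall A B (f : hom A B), compm (idm B) f = f;
  compm1 : forall A B (f : hom A B), compm f (idm A) = f;
  compBl : forall A B C (g g' : hom B C) (f : hom A B),
    compm (g - g') f = compm g f - compm g' f;
  compBr : forall A B C (g : hom B C) (f f' : hom A B),
    compm g (f - f') = compm g f - compm g f'
}.

Arguments idm {p} A.

Notation "g \oc f" := (compm g f) : cat_scope.

Section Preadditive.
Variable C : preadditive.
Implicit Types (A B S : C) (D E : C -> Prop).

Lemma comp0m A B B' (f : hom A B) : (0 : hom B B') \oc f = 0.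
Proof. by rewrite -(subrr (0 : hom B B')) compBl subrr. Qed.

Lemma compm0 A B B' (f : hom B B') : f \oc (0 : hom A B) = 0.
Proof. by rewrite -(subrr (0 : hom A B)) compBr subrr. Qed.

Lemma compDl A B B' (g g' : hom B B') (f : hom A B) :
  (g + g') \oc f = g \oc f + g' \oc f.
Proof.
by rewrite -{1}[g']opprK compBl -[- g']sub0r compBl comp0m sub0r opprK.
Qed.

Lemma compDr A B B' (g : hom B B') (f f' : hom A B) :
  g \oc (f + f') = g \oc f + g \oc f'.
Proof.
by rewrite -{1}[f']opprK compBr -[- f']sub0r compBr compm0 sub0r opprK.
Qed.

Definition is_iso A B (f : hom A B) : Prop :=
  exists g : hom B A, g \oc f = idm A /\ f \oc g = idm B.

Definition zero_object (Z : C) : Prop :=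
  forall A, (forall f : hom A Z, f = 0) /\ (forall f : hom Z A, f = 0).

Record biproduct A B S := Biproduct {
  in1 : hom A S;
  in2 : hom B S;
  pr1 : hom S A;
  pr2 : hom S B;
  pr1_in1 : pr1 \oc in1 = idm A;
  pr2_in2 : pr2 \oc in2 = idm B;
  pr1_in2 : pr1 \oc in2 = 0;
  pr2_in1 : pr2 \oc in1 = 0;
  in_pr : in1 \oc pr1 + in2 \oc pr2 = idm S
}.

Definition direct_sum A B S : Prop := inhabited (biproduct A B S).

Definition additive_category : Prop :=
  (exists Z : C, zero_object Z) /\ (forall A B, exists S, direct_sum A B S).

(* A is a direct summand of B if the identity of A factors through B.  A
   complement of A in B need not exist; it does as soon as the idempotents of
   the ambient category split. *)
Definition direct_summand A B : Prop :=
  exists (i : hom A B) (p : hom B A), p \oc i = idm A.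

Definition Ad D : C -> Prop := fun A => exists2 B, D B & direct_summand A B.

Definition plus D E : C -> Prop :=
  fun S => exists A B, [/\ D A, E B & direct_sum A B S].

Definition closed_under_sums D : Prop :=
  forall A B S, D A -> D B -> direct_sum A B S -> D S.

Definition closed_under_summands D : Prop :=
  forall A B, D B -> direct_summand A B -> D A.

(* e is the identity on A' and zero on A'', where A is the direct sum of
   A' and A''. *)
Definition splits A (e : hom A A) : Prop :=
  exists A' A'' (b : biproduct A' A'' A),
    e \oc in1 b = in1 b /\ e \oc in2 b = 0.

Definition idempotents_split : Prop :=
  forall A (e : hom A A), e \oc e = e -> splits e.

Definition factors D A B (f : hom A B) : Prop :=
  exists2 Z, D Z & exists (u : hom A Z) (v : hom Z B), f = v \oc u.

Definition quotient_defined D : Prop :=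
  forall A B, factors D (0 : hom A B) /\
    (forall f g : hom A B, factors D f -> factors D g -> factors D (f - g)).

Lemma factors_compl D A B B' (g : hom B B') (f : hom A B) :
  factors D f -> factors D (g \oc f).
Proof. by case=> Z DZ [u [v ->]]; exists Z => //; exists u, (g \oc v); rewrite compA. Qed.

Lemma factors_compr D A B B' (g : hom B B') (f : hom A B) :
  factors D g -> factors D (g \oc f).
Proof. by case=> Z DZ [u [v ->]]; exists Z => //; exists (u \oc f), v; rewrite compA. Qed.

Definition iso_mod D A B (f : hom A B) : Prop :=
  exists g : hom B A,
    factors D (g \oc f - idm A) /\ factors D (f \oc g - idm B).

(* A + Y1 is isomorphic to B + Y2 for some Y1 and Y2 in D. *)
Definition iso_upto_sums D A B : Prop :=
  exists Y1 Y2 S, [/\ D Y1, D Y2, direct_sum A Y1 S & direct_sum B Y2 S].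

End Preadditive.

Arguments additive_category : clear implicits.
Arguments idempotents_split : clear implicits.
Arguments quotient_defined : clear implicits.

Section FullSubcategory.
Variables (C : preadditive) (S : C -> Prop).

Definition full : preadditive :=
  @Preadditive {A : C | S A} (fun A B => hom (sval A) (sval B))
    (fun A => idm (sval A))
    (fun A B B' g f => g \oc f)
    (fun A B B' B'' h g f => compA h g f)
    (fun A B f => comp1m f)
    (fun A B f => compm1 f)
    (fun A B B' g g' f => compBl g g' f)
    (fun A B B' g f f' => compBr g f f').

Definition restr (D : C -> Prop) : full -> Prop := fun A => D (sval A).

Lemma quotient_defined_full (D : C -> Prop) :
  (forall A, D A -> S A) -> quotient_defined C D ->
  quotient_defined full (restr D).
Proof.
move=> sDS qD A B; have [h0 hB] := qD (sval A) (sval B).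
have fE (f : @hom full A B) :
    factors (restr D) f <-> factors D (f : hom (sval A) (sval B)).
  split=> [[Z DZ [u [v ->]]]|[Z DZ [u [v ->]]]].
    by exists (sval Z) => //; exists u, v.
  by exists (exist _ Z (sDS Z DZ)) => //; exists u, v.
by split=> [|f g /fE hf /fE hg]; apply/fE => //; apply: hB.
Qed.

End FullSubcategory.

Section Quotient.
Variables (C : preadditive) (D : C -> Prop) (qD : quotient_defined C D).

Definition factor_pred (_ : quotient_defined C D) A B : {pred hom A B} :=
  fun f => `[< factors D f >].

Lemma factor_pred_closed A B : zmod_closed (@factor_pred qD A B).
Proof.
have [h0 hB] := qD A B.
by split=> [|f g]; rewrite !unfold_in; [apply/asboolP|
  move=> /asboolP hf /asboolP hg; apply/asboolP; apply: hB].
Qed.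

HB.instance Definition _ A B :=
  GRing.isZmodClosed.Build (hom A B) (@factor_pred qD A B)
    (@factor_pred_closed A B).

Definition qhom (A B : C) : zmodType := @Quotient.quot (hom A B) (@factor_pred qD A B).

Definition cls A B (f : hom A B) : qhom A B := \pi_(qhom A B) f.

Lemma cls_eq A B (f g : hom A B) : cls f = cls g <-> factors D (f - g).
Proof.
rewrite /cls; split=> [/eqP|h]; [|apply/eqP];
  rewrite -Quotient.idealrBE unfold_in; first by move/asboolP.
exact/asboolP.
Qed.

Lemma clsB A B (f g : hom A B) : cls (f - g) = cls f - cls g.
Proof. exact: raddfB. Qed.

Lemma cls_repr A B (f : qhom A B) : cls (repr f) = f.
Proof. exact: reprK. Qed.

Lemma repr_cls A B (f : hom A B) : factors D (repr (cls f) - f).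
Proof. by apply/cls_eq; rewrite cls_repr. Qed.

Definition qcomp A B B' (g : qhom B B') (f : qhom A B) : qhom A B' :=
  cls (repr g \oc repr f).

Lemma qcomp_cls A B B' (g : hom B B') (f : hom A B) :
  qcomp (cls g) (cls f) = cls (g \oc f).
Proof.
rewrite /qcomp.
have -> : cls (repr (cls g) \oc repr (cls f)) = cls (repr (cls g) \oc f).
  by apply/cls_eq; rewrite -compBr; apply/factors_compl/repr_cls.
by apply/cls_eq; rewrite -compBl; apply/factors_compr/repr_cls.
Qed.

Lemma qcompA A B B' B'' (h : qhom B' B'') (g : qhom B B') (f : qhom A B) :
  qcomp h (qcomp g f) = qcomp (qcomp h g) f.
Proof.
by rewrite -[h]cls_repr -[g]cls_repr -[f]cls_repr !qcomp_cls compA.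
Qed.

Lemma qcomp1m A B (f : qhom A B) : qcomp (cls (idm B)) f = f.
Proof. by rewrite -[f]cls_repr qcomp_cls comp1m. Qed.

Lemma qcompm1 A B (f : qhom A B) : qcomp f (cls (idm A)) = f.
Proof. by rewrite -[f]cls_repr qcomp_cls compm1. Qed.

Lemma qcompBl A B B' (g g' : qhom B B') (f : qhom A B) :
  qcomp (g - g') f = qcomp g f - qcomp g' f.
Proof.
rewrite -[f]cls_repr -[g]cls_repr -[g']cls_repr -clsB !qcomp_cls.
by rewrite compBl clsB.
Qed.

Lemma qcompBr A B B' (g : qhom B B') (f f' : qhom A B) :
  qcomp g (f - f') = qcomp g f - qcomp g f'.
Proof.
rewrite -[f]cls_repr -[f']cls_repr -[g]cls_repr -clsB !qcomp_cls.
by rewrite compBr clsB.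
Qed.

Definition quotient : preadditive :=
  @Preadditive C qhom (fun A => cls (idm A)) qcomp
    qcompA qcomp1m qcompm1 qcompBl qcompBr.

End Quotient.

(* Functors are not assumed additive; a left adjoint between additive
   categories is, by [left_adjoint_additive] below. *)
Record functor (C D : preadditive) := Functor {
  fobj :> C -> D;
  fmap : forall A B : C, hom A B -> hom (fobj A) (fobj B);
  fmap1 : forall A, fmap (idm A) = idm (fobj A);
  fmapM : forall A B B' (g : hom B B') (f : hom A B),
    fmap (g \oc f) = fmap g \oc fmap f
}.

Definition additive_functor C D (T : functor C D) : Prop :=
  forall (A B : C) (f g : hom A B), fmap T (f - g) = fmap T f - fmap T g.

Definition idF C : functor C C :=
  @Functor C C id (fun A B f => f) (fun A => erefl) (fun A B B' g f => erefl).

Section CompFunctor.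
Variables (C D E : preadditive) (T : functor D E) (U : functor C D).

Lemma compF1 (A : C) : fmap T (fmap U (idm A)) = idm (T (U A)).
Proof. by rewrite !fmap1. Qed.

Lemma compFM (A B B' : C) (g : hom B B') (f : hom A B) :
  fmap T (fmap U (g \oc f)) = fmap T (fmap U g) \oc fmap T (fmap U f).
Proof. by rewrite !fmapM. Qed.

Definition compF : functor C E :=
  @Functor C E (fun A => T (U A)) (fun A B f => fmap T (fmap U f)) compF1 compFM.

End CompFunctor.

Notation "T \of U" := (compF T U) : cat_scope.

Record nat_trans C D (T U : functor C D) := NatTrans {
  component :> forall A : C, hom (T A) (U A);
  naturality : forall (A B : C) (f : hom A B),
    component B \oc fmap T f = fmap U f \oc component A
}.

Definition nat_iso C D (T U : functor C D) (t : nat_trans T U) : Prop :=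
  forall A, is_iso (t A).

Definition adjunction C D (T : functor C D) (U : functor D C)
    (unit : nat_trans (idF C) (U \of T)) (counit : nat_trans (T \of U) (idF D)) :
    Prop :=
  (forall A : C, counit (T A) \oc fmap T (unit A) = idm (T A)) /\
  (forall B : D, fmap U (counit B) \oc unit (U B) = idm (U B)).

Definition image_objects C D (T : functor C D) (S : C -> Prop) : D -> Prop :=
  fun B => exists2 A, S A & B = T A.

Section LeftAdjoint.
Variables (C D : preadditive) (T : functor C D) (U : functor D C).
Variables (unit : nat_trans (idF C) (U \of T)).
Variables (counit : nat_trans (T \of U) (idF D)).
Hypothesis (adj : adjunction unit counit) (addC : additive_category C).

Let tr (A : C) (B : D) (f : hom (T A) B) : hom A (U B) :=
  (fmap U f : hom (U (T A)) (U B)) \oc (unit A : hom A (U (T A))).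

Let tr_inj A B : injective (@tr A B).
Proof.
apply: (can_inj (g := fun f : hom A (U B) => (counit B : hom (T (U B)) B) \oc fmap T f)).
move=> f; rewrite /tr fmapM compA.
by rewrite (naturality counit f) /= -compA adj.1 compm1.
Qed.

Let tr_nat A A' B (f : hom (T A) B) (g : hom A' A) :
  tr (f \oc fmap T g) = tr f \oc g.
Proof.
rewrite /tr fmapM -!compA; congr (_ \oc _).
exact: esym (naturality unit g).
Qed.

Lemma left_adjoint_additive : additive_functor T.
Proof.
have [[Z Z0] sums] := addC.
have T0 (A B : C) : fmap T (0 : hom A B) = 0.
  have TZ : idm (T Z) = 0.
    by apply: tr_inj; rewrite [LHS](Z0 _).2 [RHS](Z0 _).2.
  have -> : (0 : hom A B) = (0 : hom Z B) \oc (0 : hom A Z) by rewrite compm0.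
  by rewrite fmapM -[fmap T (0 : hom A Z)]comp1m TZ comp0m compm0.
suff TD (A B : C) (f g : hom A B) : fmap T (f + g) = fmap T f + fmap T g.
  by move=> A B f g; apply/eqP; rewrite eq_sym subr_eq -TD subrK.
have [S [b]] := sums A A.
have bT : fmap T (in1 b) \oc fmap T (pr1 b) + fmap T (in2 b) \oc fmap T (pr2 b)
    = idm (T S).
  apply: tr_inj.
  set e := (X in tr X).
  have e1 : e \oc fmap T (in1 b) = idm (T S) \oc fmap T (in1 b).
    by rewrite compDl -!compA -!fmapM pr1_in1 pr2_in1 compm1 compm0 T0
               addr0 comp1m.
  have e2 : e \oc fmap T (in2 b) = idm (T S) \oc fmap T (in2 b).
    by rewrite compDl -!compA -!fmapM pr1_in2 pr2_in2 compm1 compm0 T0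
               add0r comp1m.
  rewrite -[LHS]compm1 -[RHS]compm1 -(in_pr b) !compDr !compA.
  by rewrite -!tr_nat e1 e2.
pose u := f \oc pr1 b + g \oc pr2 b; pose d := in1 b + in2 b.
have ud1 : u \oc in1 b = f.
  by rewrite compDl -!compA pr1_in1 pr2_in1 compm0 addr0 compm1.
have ud2 : u \oc in2 b = g.
  by rewrite compDl -!compA pr1_in2 pr2_in2 compm0 add0r compm1.
have d1 : pr1 b \oc d = idm A by rewrite compDr pr1_in1 pr1_in2 addr0.
have d2 : pr2 b \oc d = idm A by rewrite compDr pr2_in1 pr2_in2 add0r.
have -> : f + g = u \oc d by rewrite compDr ud1 ud2.
rewrite fmapM -[fmap T u]compm1 -bT compDr !compA -!fmapM ud1 ud2.
by rewrite compDl -!fmapM -!compA d1 d2 !compm1.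
Qed.

End LeftAdjoint.

Section RestrictedFunctor.
Variables (C D : preadditive) (T : functor C D) (S : C -> Prop) (S' : D -> Prop).
Hypothesis hS : forall A, S A -> S' (T A).

Definition restrF : functor (full S) (full S') :=
  @Functor (full S) (full S')
    (fun A => exist _ (T (sval A)) (hS (svalP A)))
    (fun A B f => fmap T (f : hom (sval A) (sval B)))
    (fun A => fmap1 T (sval A))
    (fun A B B' g f => fmapM T (g : hom (sval B) (sval B'))
                              (f : hom (sval A) (sval B))).

End RestrictedFunctor.

Section QuotientFunctor.
Variables (C D : preadditive) (T : functor C D) (E : C -> Prop) (E' : D -> Prop).
Hypotheses (addT : additive_functor T) (hE : forall A, E A -> E' (T A)).
Variables (qE : quotient_defined C E) (qE' : quotient_defined D E').

Definition quotF_map A B (f : qhom qE A B) : qhom qE' (T A) (T B) :=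
  cls qE' (fmap T (repr f)).

Lemma quotF_map_cls A B (f : hom A B) :
  quotF_map (cls qE f) = cls qE' (fmap T f).
Proof.
apply/cls_eq; rewrite -addT.
have [Z EZ [u [v ->]]] := repr_cls qE f.
by exists (T Z); [exact: hE|exists (fmap T u), (fmap T v); rewrite fmapM].
Qed.

Lemma quotF1 A : quotF_map (cls qE (idm A)) = cls qE' (idm (T A)).
Proof. by rewrite quotF_map_cls fmap1. Qed.

Lemma quotFM A B B' (g : qhom qE B B') (f : qhom qE A B) :
  quotF_map (qcomp g f) = qcomp (quotF_map g) (quotF_map f).
Proof.
by rewrite -[g]cls_repr -[f]cls_repr qcomp_cls !quotF_map_cls qcomp_cls fmapM.
Qed.

Definition quotF : functor (quotient qE) (quotient qE') :=
  @Functor (quotient qE) (quotient qE') T quotF_map quotF1 quotFM.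

End QuotientFunctor.

Section Correspondence.
Variables (H G : preadditive) (I : functor H G) (R : functor G H).
Variables (F : functor H H) (X L : H -> Prop).

Definition subM : G -> Prop := Ad (image_objects I L).
Definition subY : H -> Prop := plus X (Ad (image_objects F L)).
Definition subL' : H -> Prop := plus L (Ad (image_objects F L)).

Hypothesis hXL : forall A, X A -> L A.
Hypothesis qX : quotient_defined H X.
Hypothesis qIX : quotient_defined G (image_objects I X).

Lemma I_subM A : L A -> subM (I A).
Proof.
by move=> LA; exists (I A); [exists A|exists (idm _), (idm _); rewrite comp1m].
Qed.

Lemma IX_subM B : image_objects I X B -> subM B.
Proof. by case=> A XA ->; apply/I_subM/hXL. Qed.

Definition quotLX : preadditive := quotient (quotient_defined_full hXL qX).

Definition quotMIX : preadditive := quotient (quotient_defined_full IX_subM qIX).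

Lemma I_restr (A : full L) :
  restr X A -> restr (image_objects I X) (restrF I_subM A).
Proof. by move=> XA; exists (sval A). Qed.

Hypothesis addI : additive_functor I.

Definition bbI : functor quotLX quotMIX :=
  quotF (T := restrF I_subM) (fun A B => @addI (sval A) (sval B)) I_restr
    (quotient_defined_full hXL qX) (quotient_defined_full IX_subM qIX).

(* [RR : M/I(X) -> L/X] is induced by R.  First, the composite of RR with
   L/X -> H/Y is isomorphic, through t, to the functor M/I(X) -> H/Y that R
   induces; this is spelled out on representatives in H.  Second, RR(M) is an
   L' in L with R(M) + Y1 isomorphic to L' + Y2 for some Y1, Y2 in Y, for
   every M that admits such an L'. *)
Definition induced_by_R (RR : functor quotMIX quotLX) : Prop :=
  (exists t : forall M : full subM, hom (R (sval M)) (sval (RR M)),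
     (forall M, iso_mod subY (t M)) /\
     (forall (M N : full subM) (f : hom (sval M) (sval N))
             (g : hom (sval (RR M)) (sval (RR N))),
        cls (quotient_defined_full hXL qX) (A := RR M) (B := RR N) g =
          fmap RR (cls (quotient_defined_full IX_subM qIX) (A := M) (B := N) f) ->
        factors subY (g \oc t M - t N \oc fmap R f))) /\
  (forall M : full subM,
     (exists2 L' : H, L L' & iso_upto_sums subY (R (sval M)) L') ->
     iso_upto_sums subY (R (sval M)) (sval (RR M))).

End Correspondence.

(* Main.v *)
From mathcomp Require Import all_boot ssralg boolp.
Require Import Defs.

(* By adjunction, maps I A -> I B correspond to maps A -> R I B = B + F B.
   Since F B lies in Y, hypothesis (6) says that every map A -> F B with A and B
   in L factors through X; so I is full and faithful modulo X.  An object M of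
   Ad(I(L)) is the image of an idempotent of some I B; that idempotent comes
   from one of B in H/X, and splitting the latter yields an A in L with M
   isomorphic to I A modulo I(X).  Modulo Y, R M is then isomorphic to R I A,
   hence to A, since F A lies in Y. *)

Set Implicit Arguments.
Unset Strict Implicit.
Unset Printing Implicit Defensive.

Import GRing.Theory.
Local Open Scope ring_scope.
Local Open Scope cat_scope.

(** * Isomorphisms, and transport of biproducts along them *)

Section Isomorphisms.
Variables (C : preadditive).

Lemma is_iso_comp (A B B' : C) (g : hom B B') (f : hom A B) :
  is_iso g -> is_iso f -> is_iso (g \oc f).
Proof.
move=> [g' [g'g gg']] [f' [f'f ff']]; exists (f' \oc g'); split.
  by rewrite -compA (compA g') g'g comp1m.
by rewrite -compA (compA f) ff' comp1m.
Qed.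

Lemma is_iso_inverse (A B : C) (f : hom A B) (g : hom B A) :
  g \oc f = idm A -> f \oc g = idm B -> is_iso g.
Proof. by exists f. Qed.

Lemma biproduct_iso (A B S S' : C) (b : biproduct A B S) (f : hom S S') :
  is_iso f -> exists b' : biproduct A B S',
    in1 b' = f \oc in1 b /\ in2 b' = f \oc in2 b.
Proof.
case=> g [gf fg].
have gfK A' (h : hom A' S) : g \oc (f \oc h) = h by rewrite compA gf comp1m.
unshelve eexists.
  apply: (@Biproduct _ _ _ _ (f \oc in1 b) (f \oc in2 b)
    (pr1 b \oc g) (pr2 b \oc g)).
  - by rewrite -compA gfK pr1_in1.
  - by rewrite -compA gfK pr2_in2.
  - by rewrite -compA gfK pr1_in2.
  - by rewrite -compA gfK pr2_in1.
  - by rewrite -!(compA f) !compA -!(compA f) -compDr -compDl in_pr comp1m.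
by [].
Qed.

End Isomorphisms.

Lemma is_iso_fmap (C D : preadditive) (T : functor C D) (A B : C) (f : hom A B) :
  is_iso f -> is_iso (fmap T f).
Proof.
by case=> g [gf fg]; exists (fmap T g); rewrite -!fmapM gf fg !fmap1.
Qed.

(** * Maps that factor through a class of objects, and invertibility modulo these maps *)

Section Factors.
Variables (C : preadditive) (D : C -> Prop).

(** If two maps factor through [Z1] and [Z2], their difference factors through the sum of [Z1] and
    [Z2] in [D]. This is what makes [H/Y] available. *)
Lemma additive_quotient_defined :
  additive_category (full D) -> quotient_defined C D.
Proof.
move=> [[Z _] sums] A B; split.
  by exists (sval Z); [exact: svalP|exists 0, 0; rewrite comp0m].
move=> f g [Z1 D1 [u1 [v1 ->]]] [Z2 D2 [u2 [v2 ->]]].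
have [S [b]] := sums (exist _ Z1 D1) (exist _ Z2 D2).
pose i1 : hom Z1 (sval S) := in1 b; pose i2 : hom Z2 (sval S) := in2 b.
pose p1 : hom (sval S) Z1 := pr1 b; pose p2 : hom (sval S) Z2 := pr2 b.
have p11 : p1 \oc i1 = idm Z1 := pr1_in1 b.
have p22 : p2 \oc i2 = idm Z2 := pr2_in2 b.
have p12 : p1 \oc i2 = 0 := pr1_in2 b.
have p21 : p2 \oc i1 = 0 := pr2_in1 b.
exists (sval S); first exact: svalP.
exists (i1 \oc u1 + i2 \oc u2), (v1 \oc p1 - v2 \oc p2).
rewrite compBl !compDr -!compA !(compA p1) !(compA p2) p11 p12 p21 p22.
by rewrite !comp1m !comp0m !compm0 addr0 add0r.
Qed.

Hypothesis qD : quotient_defined C D.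

Lemma factors0 (A B : C) : factors D (0 : hom A B).
Proof. by case: (qD A B). Qed.

Lemma factorsD (A B : C) (f g : hom A B) :
  factors D f -> factors D g -> factors D (f + g).
Proof.
have [h0 hB] := qD A B.
by move=> hf hg; rewrite -[g]opprK -[- g]sub0r; apply/hB/hB.
Qed.

Lemma iso_modE (A B : C) (f : hom A B) :
  iso_mod D f <-> is_iso (cls qD f : @hom (quotient qD) A B).
Proof.
split=> [[g [gf fg]]|[g [gf fg]]].
  by exists (cls qD g); split; rewrite /= qcomp_cls; apply/cls_eq.
exists (repr g); split; apply/(cls_eq qD).
  by rewrite -qcomp_cls cls_repr.
by rewrite -qcomp_cls cls_repr.
Qed.

(** The inverse modulo [D] is the opposite composite [pr1 b1 \oc in1 b2]: since the two idempotents
    of a biproduct add up to the identity, each round trip misses only a map through [Y1] or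
    [Y2]. *)
Lemma iso_mod_upto_sums (A B Y1 Y2 S : C)
    (b1 : biproduct A Y1 S) (b2 : biproduct B Y2 S) :
  D Y1 -> D Y2 -> iso_mod D (pr1 b2 \oc in1 b1).
Proof.
have gen A' B' Z1 Z2 (c1 : biproduct A' Z1 S) (c2 : biproduct B' Z2 S) : D Z2 ->
    factors D ((pr1 c1 \oc in1 c2) \oc (pr1 c2 \oc in1 c1) - idm A').
  move=> DZ2; exists Z2 => //.
  exists (- (pr2 c2 \oc in1 c1)), (pr1 c1 \oc in2 c2).
  apply/eqP; rewrite subr_eq -[- (_ \oc _)]sub0r compBr compm0 sub0r addrC.
  rewrite eq_sym subr_eq eq_sym; apply/eqP.
  rewrite -!(compA (pr1 c1)) -compDr.
  by rewrite !(compA _ _ (in1 c1)) -compDl in_pr comp1m pr1_in1.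
by move=> D1 D2; exists (pr1 b1 \oc in1 b2); split; apply: gen.
Qed.

End Factors.

Lemma factors_restr (C : preadditive) (S D : C -> Prop) :
  (forall A, D A -> S A) ->
  forall (A B : full S) (f : hom (sval A) (sval B)),
  factors (restr D) (f : @hom (full S) A B) <-> factors D f.
Proof.
move=> sDS A B f; split=> [[Z DZ [u [v ->]]]|[Z DZ [u [v ->]]]].
  by exists (sval Z) => //; exists u, v.
by exists (exist _ Z (sDS Z DZ)) => //; exists u, v.
Qed.

Lemma cls_full_eq (C : preadditive) (S D : C -> Prop) (sDS : forall A, D A -> S A)
    (qS : quotient_defined (full S) (restr D)) (A B : full S)
    (f g : hom (sval A) (sval B)) :
  cls qS (A := A) (B := B) f = cls qS (A := A) (B := B) g <-> factors D (f - g).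
Proof. by rewrite cls_eq -(factors_restr sDS). Qed.

Lemma iso_mod_full (C : preadditive) (S D : C -> Prop) (sDS : forall A, D A -> S A)
    (qS : quotient_defined (full S) (restr D)) (A B : full S)
    (f : hom (sval A) (sval B)) :
  iso_mod D f -> is_iso (cls qS (A := A) (B := B) f : @hom (quotient qS) A B).
Proof.
case=> g [gf fg]; apply/(iso_modE qS); exists g.
by split; apply/(factors_restr sDS).
Qed.

(** * Additivity of right adjoints *)

Section RightAdjoint.
Variables (C D : preadditive) (T : functor C D) (U : functor D C).
Variables (unit : nat_trans (idF C) (U \of T)).
Variables (counit : nat_trans (T \of U) (idF D)).
Hypothesis (adj : adjunction unit counit).

Lemma transpose_inj (A : C) (B : D) :
  injective (fun f : hom A (U B) => (counit B : hom (T (U B)) B) \oc fmap T f).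
Proof.
apply: (can_inj (g := fun f : hom (T A) B =>
  fmap U f \oc (unit A : hom A (U (T A))))) => f.
by rewrite fmapM -compA -(naturality unit f) /= compA adj.2 comp1m.
Qed.

(** By naturality of the counit, the transpose of [fmap U h] is [h] composed with the counit, which
    is additive in [h]; transposition is additive with [T], and injective. *)
Lemma right_adjoint_additive : additive_functor T -> additive_functor U.
Proof.
move=> addT A B f g; apply: transpose_inj => /=.
rewrite addT compBr.
have nat (h : hom A B) : (counit B : hom (T (U B)) B) \oc fmap T (fmap U h) =
    h \oc (counit A : hom (T (U A)) A) := naturality counit h.
by rewrite !nat compBl.
Qed.

End RightAdjoint.

(** * Quasi-inverse of a fully faithful, essentially surjective functor, from chosen data *)

Section QuasiInverse.
Variables (C D : preadditive) (T : functor C D).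
Variables (lift : forall A B : C, hom (T A) (T B) -> hom A B).
Hypothesis fmap_lift : forall A B (f : hom (T A) (T B)), fmap T (lift f) = f.
Hypothesis fmap_inj : forall A B : C, injective (@fmap _ _ T A B).
Variables (N : D -> C) (j : forall B, hom B (T (N B))) (k : forall B, hom (T (N B)) B).
Hypothesis kj : forall B, k B \oc j B = idm B.
Hypothesis jk : forall B, j B \oc k B = idm (T (N B)).

(** By faithfulness this is the only map that [T] sends to the conjugate of [f] by the chosen
    isomorphisms; identities between such maps can therefore be checked after applying [T]. *)
Definition qinv_map (A B : D) (f : hom A B) : hom (N A) (N B) :=
  lift (j B \oc f \oc k A).

Lemma qinv1 A : qinv_map (idm A) = idm (N A).
Proof. by apply: fmap_inj; rewrite fmap_lift fmap1 compm1 jk. Qed.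

Lemma qinvM A B B' (g : hom B B') (f : hom A B) :
  qinv_map (g \oc f) = qinv_map g \oc qinv_map f.
Proof.
apply: fmap_inj; rewrite fmapM !fmap_lift -!compA.
by rewrite (compA (k B)) kj comp1m.
Qed.

Definition qinv : functor D C := Functor qinv1 qinvM.

Lemma qinv_unit_nat (A B : C) (f : hom A B) :
  lift (j (T B)) \oc fmap (idF C) f = fmap (qinv \of T) f \oc lift (j (T A)).
Proof.
apply: fmap_inj; rewrite /= !fmapM !fmap_lift.
by rewrite -compA kj compm1.
Qed.

Definition qinv_unit : nat_trans (idF C) (qinv \of T) :=
  @NatTrans C C (idF C) (qinv \of T) (fun A => lift (j (T A))) qinv_unit_nat.

Lemma qinv_counit_nat (A B : D) (f : hom A B) :
  k B \oc fmap (T \of qinv) f = fmap (idF D) f \oc k A.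
Proof. by rewrite /= fmap_lift !compA kj comp1m. Qed.

Definition qinv_counit : nat_trans (T \of qinv) (idF D) :=
  @NatTrans D D (T \of qinv) (idF D) k qinv_counit_nat.

Lemma qinv_equivalence :
  [/\ adjunction qinv_unit qinv_counit, nat_iso qinv_unit & nat_iso qinv_counit].
Proof.
split.
- split=> [A|B] /=; first by rewrite fmap_lift kj.
  by apply: fmap_inj; rewrite fmapM !fmap_lift fmap1 -!compA kj compm1 jk.
- move=> A; exists (lift (k (T A))).
  by split; apply: fmap_inj; rewrite fmapM !fmap_lift fmap1 ?kj ?jk.
- by move=> B; exists (j B); rewrite kj jk.
Qed.

End QuasiInverse.

(** * Comparison of [I] and [R] modulo [X], [I(X)] and [Y] *)

Section Correspondence.
Variables (H G : preadditive) (I : functor H G) (R : functor G H).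
Variables (F : functor H H) (X L : H -> Prop).
Hypotheses (hXL : forall A, X A -> L A).
Hypotheses (addH : additive_category H).
Hypotheses (X_inh : exists Z, X Z).
Hypotheses (sumL : closed_under_sums L) (smdL : closed_under_summands L).
Hypotheses (qX : quotient_defined H X).
Hypotheses (qIX : quotient_defined G (image_objects I X)).
Hypotheses (qY : quotient_defined H (subY F X L)).
Variables (eps : nat_trans (idF H) (R \of I)) (eta : nat_trans (I \of R) (idF G)).
Hypothesis (adj : adjunction eps eta).
Variables (phi : nat_trans F (R \of I)).
Hypothesis (eps_phi_iso : forall (A S : H) (b : biproduct A (F A) S),
  is_iso ((eps A : hom A (R (I A))) \oc pr1 b
          + (phi A : hom (F A) (R (I A))) \oc pr2 b)).
Hypothesis (factL : forall (A B : H), L A -> L B ->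
     (forall gamma : hom A (F B),
        factors (subY F X L) gamma -> factors X gamma) /\
     (forall delta : hom (F B) A,
        factors (subY F X L) delta -> factors X delta)).
Hypothesis (splitHX : idempotents_split (quotient qX)).
Hypotheses (addI : additive_functor I) (addR : additive_functor R).

Notation Y := (subY F X L).
Notation IX := (image_objects I X).

(** Any biproduct of [A] and [F A] is transported along the isomorphism given by [eps] and [phi]. *)
Lemma RI_biproduct (A : H) : exists b : biproduct A (F A) (R (I A)),
  in1 b = (eps A : hom A (R (I A))) /\ in2 b = (phi A : hom (F A) (R (I A))).
Proof.
have [_ /(_ A (F A)) [S [b]]] := addH.
have [b' [b'1 b'2]] := biproduct_iso b (eps_phi_iso b).
exists b'; rewrite b'1 b'2 !compDl -!compA pr1_in1 pr2_in1 pr1_in2 pr2_in2.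
by rewrite !compm0 !compm1 addr0 add0r.
Qed.

Definition bRI (A : H) : biproduct A (F A) (R (I A)) := sval (cid (RI_biproduct A)).

Lemma in1_bRI A : in1 (bRI A) = (eps A : hom A (R (I A))).
Proof. by rewrite /bRI; case: cid => b []. Qed.

Lemma in2_bRI A : in2 (bRI A) = (phi A : hom (F A) (R (I A))).
Proof. by rewrite /bRI; case: cid => b []. Qed.

(** It suffices to compare both sides on the two summands, and naturality of [eps] and [phi] says
    that [fmap R (fmap I f)] is diagonal, with entries [f] and [fmap F f]. *)
Lemma pr1_bRI_nat (A B : H) (f : hom A B) :
  pr1 (bRI B) \oc fmap R (fmap I f) = f \oc pr1 (bRI A).
Proof.
rewrite -[LHS]compm1 -[RHS]compm1 -(in_pr (bRI A)) !compDr !compA.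
rewrite -!(compA (pr1 (bRI B))) -(compA f).
have e1 : fmap R (fmap I f) \oc in1 (bRI A) = in1 (bRI B) \oc f.
  by rewrite !in1_bRI; apply: esym (naturality eps f).
have e2 : fmap R (fmap I f) \oc in2 (bRI A) = in2 (bRI B) \oc fmap F f.
  by rewrite !in2_bRI; apply: esym (naturality phi f).
rewrite e1 e2 !(compA (pr1 (bRI B))) pr1_in1 pr1_in2 comp1m comp0m.
by rewrite pr1_in1 compm1 -(compA f) pr1_in2 compm0 !comp0m.
Qed.

Lemma plus_subY (A B S : H) : X A -> L B -> direct_sum A (F B) S -> Y S.
Proof.
move=> XA LB h; exists A, (F B); split=> //.
by exists (F B); [exists B|exists (idm _), (idm _); rewrite comp1m].
Qed.

(** This lets [R] descend to a functor from [G/I(X)] to [H/Y]. *)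
Lemma RI_subY (A : G) : IX A -> Y (R A).
Proof.
by case=> B XB ->; apply: (plus_subY XB (hXL XB)); exists; apply: bRI.
Qed.

(** [F B] is a summand of its sum with any object of [X], and that sum lies in [Y]. *)
Lemma F_factors (A B : H) (f : hom A (F B)) : L B -> factors Y f.
Proof.
move=> LB; have [Z XZ] := X_inh; have [_ /(_ Z (F B)) [S [b]]] := addH.
exists S; first by apply: (plus_subY XZ LB); exists.
by exists (in2 b \oc f), (pr2 b); rewrite compA pr2_in2 comp1m.
Qed.

Lemma LF_factors (A B : H) (f : hom A (F B)) : L A -> L B -> factors X f.
Proof.
by move=> LA LB; apply: (factL LA LB).1; apply: F_factors.
Qed.

(** Split the map along the middle object [A' + B']. One part factors through [A'] in [X]; in the
    other, [B'] is a summand of some [F B0], so the part passes through a map from [A] to [F B0], to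
    which [LF_factors] applies. *)
Lemma LL_factors (A B : H) (f : hom A B) :
  L A -> L B -> factors Y f -> factors X f.
Proof.
move=> LA LB [S [A' [B' [XA' [_ [B0 LB0 ->] [i [p pi]]] [b]]]] [u [v ->]]].
rewrite -[v]compm1 -(in_pr b) !compDr compDl; apply: (factorsD qX).
  by exists A' => //; exists (pr1 b \oc u), (v \oc in1 b); rewrite !compA.
rewrite -[pr2 b]comp1m -pi -!compA; do 2 apply: factors_compl.
by apply/factors_compl/LF_factors.
Qed.

Lemma iso_mod_LL (A B : H) (f : hom A B) :
  L A -> L B -> iso_mod Y f -> iso_mod X f.
Proof.
by move=> LA LB [g [gf fg]]; exists g; split; apply: LL_factors.
Qed.

Lemma I_IX (A : H) : X A -> IX (I A).
Proof. by exists A. Qed.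

Lemma factors_I (A B : H) (f : hom A B) : factors X f -> factors IX (fmap I f).
Proof.
case=> Z XZ [u [v ->]]; exists (I Z); first exact: I_IX.
by exists (fmap I u), (fmap I v); rewrite fmapM.
Qed.

(** The preimage is the [B]-component of the transpose of [f], a map from [A] to [R (I B)]; the
    error comes from the component in [F B]. *)
Lemma I_full (A B : H) (f : hom (I A) (I B)) : L A -> L B ->
  exists g : hom A B, factors IX (f - fmap I g).
Proof.
move=> LA LB; pose t := fmap R f \oc in1 (bRI A).
exists (pr1 (bRI B) \oc t).
(* Transposing the decomposition of [t] back: the part along [eps] gives [fmap I] of the
   [B]-component by a triangle identity, so the difference is the transpose of the part along
   [phi]. *)
have -> : f - fmap I (pr1 (bRI B) \oc t) =
    (eta (I B) : hom (I (R (I B))) (I B)) \oc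
      fmap I (in2 (bRI B) \oc (pr2 (bRI B) \oc t)).
  apply/eqP; rewrite subr_eq addrC; apply/eqP.
  rewrite -[fmap I (pr1 _ \oc _)]comp1m -(adj.1 B) -in1_bRI.
  rewrite -compA -compDr -fmapM.
  have addID (u v : hom A (R (I B))) : fmap I u + fmap I v = fmap I (u + v).
    by apply/eqP; rewrite eq_sym -subr_eq -addI addrK.
  rewrite addID !(compA _ _ t) -compDl in_pr comp1m /t fmapM compA.
  have /= -> := naturality eta f.
  by rewrite -compA in1_bRI adj.1 compm1.
by apply/factors_compl/factors_I/factors_compl/LF_factors.
Qed.

(** [f] is recovered from [fmap R (fmap I f)] as its diagonal entry, so it factors through
    [R (I Z)], which is in [Y]; between objects of [L] this is enough. *)
Lemma I_faithful (A B : H) (f : hom A B) : L A -> L B ->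
  factors IX (fmap I f) -> factors X f.
Proof.
move=> LA LB [_ [Z XZ ->] [u [v uv]]].
have -> : f = (pr1 (bRI B) \oc fmap R v) \oc (fmap R u \oc in1 (bRI A)).
  rewrite -!compA (compA (fmap R v)) -fmapM -uv compA pr1_bRI_nat -compA.
  by rewrite pr1_in1 compm1.
apply: LL_factors => //; exists (R (I Z)); first exact/RI_subY/I_IX.
by exists (fmap R u \oc in1 (bRI A)), (pr1 (bRI B) \oc fmap R v).
Qed.

Let QI : functor (quotient qX) (quotient qIX) :=
  quotF addI I_IX qX qIX.
Let QR : functor (quotient qIX) (quotient qY) := quotF addR RI_subY qIX qY.

Lemma iso_mod_pr1 (A : H) : L A -> iso_mod Y (pr1 (bRI A)).
Proof.
move=> LA; exists (in1 (bRI A)); split; last first.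
  by rewrite pr1_in1 subrr; apply: factors0.
have -> : in1 (bRI A) \oc pr1 (bRI A) - idm _ =
    in2 (bRI A) \oc (0 - pr2 (bRI A)).
  apply/eqP; rewrite subr_eq compBr compm0 sub0r addrC eq_sym subr_eq.
  by rewrite in_pr.
exact/factors_compl/F_factors.
Qed.

(** The functor [QR] preserves the isomorphism [j], and the projection of [R (I A)] onto [A] is
    invertible modulo [Y]. *)
Lemma iso_mod_pr1_R (M : G) (A : H) (j : hom M (I A)) :
  L A -> iso_mod IX j -> iso_mod Y (pr1 (bRI A) \oc fmap R j).
Proof.
move=> LA /(iso_modE qIX) isoj; apply/(iso_modE qY); rewrite -qcomp_cls.
apply: (@is_iso_comp (quotient qY)); first exact/iso_modE/iso_mod_pr1.
have := is_iso_fmap QR isoj.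
by rewrite /= (quotF_map_cls addR RI_subY).
Qed.

Lemma subM_iso_L (M : G) : subM I L M ->
  exists2 A, L A & exists j : hom M (I A), iso_mod IX j.
Proof.
move=> [_ [B LB ->] [i [p pi]]].
have [a Ia] := I_full (i \oc p) LB LB.
have {}Ia : cls qIX (i \oc p) = cls qIX (fmap I a) by apply/cls_eq.
(* Since [p \oc i] is the identity, [i \oc p] is idempotent; faithfulness carries this back to
   [a]. *)
have aa : qcomp (cls qX a) (cls qX a) = cls qX a.
  rewrite qcomp_cls; apply/cls_eq/I_faithful => //.
  rewrite addI; apply/(cls_eq qIX).
  by rewrite fmapM -qcomp_cls -Ia qcomp_cls -compA (compA p) pi comp1m.
have [A [A'' [b [a1 a2]]]] := splitHX aa.
have {a1 a2} ipE : cls qX a = in1 b \oc pr1 b.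
  rewrite -[LHS](@compm1 (quotient qX)) -(in_pr b) compDr !compA.
  by rewrite a1 a2 comp0m addr0.
exists A.
  (* The splitting lives in [H/X]: in [H], the identity of [A] is [p0 \oc i0] only up to a map
     through some [Z] in [X]. Hence [A] is a direct summand of [B + Z], which lies in [L]. *)
  pose A0 : H := A.
  pose i0 : hom A0 B := repr (in1 b); pose p0 : hom B A0 := repr (pr1 b).
  have : factors X (p0 \oc i0 - idm A0).
    by apply/(cls_eq qX); rewrite -qcomp_cls !cls_repr; apply: (pr1_in1 b).
  case=> Z XZ [u [v uv]].
  have [_ /(_ B Z) [S [c]]] := addH.
  apply: (smdL (B := S)); first by apply: (sumL LB (hXL XZ)); exists.
  exists (in1 c \oc i0 + in2 c \oc u), (p0 \oc pr1 c - v \oc pr2 c).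
  rewrite compBl !compDr -!compA !(compA (pr1 c)) !(compA (pr2 c)).
  rewrite pr1_in1 pr2_in2 pr1_in2 pr2_in1 !comp1m !comp0m !compm0 addr0 add0r.
  by rewrite -uv subKr.
pose Ii : @hom (quotient qIX) _ _ := fmap QI (in1 b).
pose Ip : @hom (quotient qIX) _ _ := fmap QI (pr1 b).
pose ci : @hom (quotient qIX) M (I B) := cls qIX i.
pose cp : @hom (quotient qIX) (I B) M := cls qIX p.
have cpi : cp \oc ci = idm (M : quotient qIX) by rewrite /= qcomp_cls pi.
(* [M] and [I A] thus split the same idempotent of [I B] in [G/I(X)], and are isomorphic there. *)
have cip : ci \oc cp = Ii \oc Ip.
  rewrite /Ii /Ip -fmapM -ipE /= (quotF_map_cls addI I_IX) /ci /cp.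
  by rewrite qcomp_cls.
have Ipi : Ip \oc Ii = idm _ by rewrite /Ip /Ii -fmapM pr1_in1 fmap1.
exists (repr (Ip \oc ci)); apply/(iso_modE qIX); rewrite cls_repr.
exists (cp \oc Ii); split.
  by rewrite -compA (compA Ii) -cip -(compA ci) cpi compm1 cpi.
by rewrite -compA (compA ci) cip -(compA Ii) Ipi compm1 Ipi.
Qed.

(* The second clause of [induced_by_R] is met by taking for A the given L'
   whenever there is one: L' is isomorphic to R M, hence to any other candidate,
   modulo Y, and between objects of L this is the same as modulo X. *)
Lemma subM_iso_preferred (M : G) : subM I L M ->
  exists2 A, L A & (exists j : hom M (I A), iso_mod IX j) /\
    ((exists2 L', L L' & iso_upto_sums Y (R M) L') -> iso_upto_sums Y (R M) A).
Proof.
move=> /subM_iso_L [A LA [j isoj]].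
have [[L' LL' RL']|noL'] := pselect (exists2 L', L L' & iso_upto_sums Y (R M) L');
  last by exists A => //; split; [exists j|].
exists L' => //; split=> //.
have [Y1 [Y2 [S [Y1Y Y2Y [b1] [b2]]]]] := RL'.
have /(iso_modE qY) isoL' := iso_mod_upto_sums b1 b2 Y1Y Y2Y.
have /(iso_modE qY) [r [rt tr]] := iso_mod_pr1_R LA isoj.
have isor := is_iso_inverse rt tr.
have := is_iso_comp isoL' isor; rewrite -[X in is_iso X]cls_repr.
move=> /iso_modE /(iso_mod_LL LA LL') /(iso_modE qX) /(is_iso_fmap QI).
move=> isoI; move/(iso_modE qIX): isoj => /(is_iso_comp isoI).
rewrite -[X in is_iso X]cls_repr => /iso_modE isoj'.
by eexists; apply: isoj'.
Qed.

(** * Passage to the quotients of the full subcategories *)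

Let IXM := @IX_subM H G I X L hXL.
Let qLX := quotient_defined_full hXL qX.
Let qMIX := quotient_defined_full IXM qIX.
Let II := bbI hXL qX qIX addI.

Lemma bbI_cls (A B : full L) (f : hom (sval A) (sval B)) :
  fmap II (cls qLX (A := A) (B := B) f) =
    cls qMIX (A := II A) (B := II B) (fmap I f).
Proof.
have h := @quotF_map_cls (full L) (full (subM I L)) (restrF (@I_subM H G I L))
  (restr X) (restr IX) (fun A B => @addI (sval A) (sval B))
  (@I_restr H G I X L) qLX qMIX A B f.
by apply: h.
Qed.

Lemma bbI_full (A B : quotLX hXL qX) (f : hom (II A) (II B)) :
  exists g : hom A B, fmap II g = f.
Proof.
have [g fg] := I_full (repr f : hom (I (sval A)) (I (sval B))) (svalP A) (svalP B).
exists (cls qLX (A := A) (B := B) g); rewrite bbI_cls -[RHS]cls_repr.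
by apply/esym/(cls_full_eq IXM).
Qed.

Lemma bbI_faithful (A B : quotLX hXL qX) : injective (@fmap _ _ II A B).
Proof.
move=> f g; rewrite -[f]cls_repr -[g]cls_repr !bbI_cls => /(cls_full_eq IXM).
rewrite -addI => h; apply/(cls_full_eq hXL).
exact: (I_faithful (svalP A) (svalP B) h).
Qed.

End Correspondence.

(** * Assembly of the quasi-inverse and its relation to [R] *)

Theorem theorem6p1
  (H G : preadditive)
  (I : functor H G) (R : functor G H) (F : functor H H)
  (X L : H -> Prop)
  (hXL : forall A, X A -> L A)
  (addH : additive_category H) (addG : additive_category G)
  (addX : additive_category (full X)) (addL : additive_category (full L))
  (addM : additive_category (full (subM I L)))
  (addY : additive_category (full (subY F X L)))
  (addL' : additive_category (full (subL' F L)))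
  (sumL : closed_under_sums L) (sumX : closed_under_sums X)
  (smdL : closed_under_summands L) (smdX : closed_under_summands X)
  (qX : quotient_defined H X)
  (qIX : quotient_defined G (image_objects I X))
  (eps : nat_trans (idF H) (R \of I))
  (eta : nat_trans (I \of R) (idF G))
  (adj : adjunction eps eta)
  (phi : nat_trans F (R \of I))
  (eps_phi_iso : forall (A S : H) (b : biproduct A (F A) S),
     is_iso ((eps A : hom A (R (I A))) \oc pr1 b
             + (phi A : hom (F A) (R (I A))) \oc pr2 b))
  (factL : forall (A B : H), L A -> L B ->
     (forall gamma : hom A (F B),
        factors (subY F X L) gamma -> factors X gamma) /\
     (forall delta : hom (F B) A,
        factors (subY F X L) delta -> factors X delta))
  (splitHX : idempotents_split (quotient qX)) :
  let II := bbI hXL qX qIX (left_adjoint_additive adj addH) in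
  exists RR : functor (quotMIX hXL qIX) (quotLX hXL qX),
    induced_by_R R F RR /\
    exists (unit : nat_trans (idF (quotLX hXL qX)) (RR \of II))
           (counit : nat_trans (II \of RR) (idF (quotMIX hXL qIX))),
      [/\ adjunction unit counit, nat_iso unit & nat_iso counit].
Proof.
set addI := left_adjoint_additive adj addH.
have addR := right_adjoint_additive adj addI.
have qY := additive_quotient_defined addY.
have X_inh : exists Z, X Z.
  by have [[Z _] _] := addX; exists (sval Z); apply: svalP.
pose II := bbI hXL qX qIX addI.
pose IXM := @IX_subM H G I X L hXL.
pose qMIX := quotient_defined_full IXM qIX.
have II_full (A B : quotLX hXL qX) (f : hom (II A) (II B)) :
    exists g : hom A B, fmap II g = f.
  exact: (bbI_full addH X_inh adj eps_phi_iso factL f).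
have II_inj (A B : quotLX hXL qX) : injective (@fmap _ _ II A B).
  move=> f g; exact: (bbI_faithful addH X_inh eps_phi_iso factL).
(* A single choice of [N M] has to serve both the equivalence and the second clause of
   [induced_by_R]. *)
have /choice [N NP] : forall M : full (subM I L), exists A : full L,
    (exists j : hom (sval M) (I (sval A)), iso_mod (image_objects I X) j) /\
    ((exists2 L', L L' & iso_upto_sums (subY F X L) (R (sval M)) L') ->
     iso_upto_sums (subY F X L) (R (sval M)) (sval A)).
  move=> [M MM]; have [A LA h] := subM_iso_preferred hXL addH X_inh sumL smdL
    qIX qY adj eps_phi_iso factL splitHX addI addR MM.
  by exists (exist _ A LA).
pose j M := sval (cid (NP M).1).
have jP M : iso_mod (image_objects I X) (j M) by rewrite /j; case: cid.
pose cj M : @hom (quotMIX hXL qIX) M (II (N M)) :=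
  cls qMIX (A := M) (B := II (N M)) (j M).
have cjP M : is_iso (cj M).
  exact: (iso_mod_full (A := M) (B := II (N M)) IXM qMIX (jP M)).
pose k M := sval (cid (cjP M)).
have kj M : k M \oc cj M = idm M by rewrite /k; case: cid => ? [].
have jk M : cj M \oc k M = idm (II (N M)) by rewrite /k; case: cid => ? [].
pose lift (A B : quotLX hXL qX) (f : hom (II A) (II B)) :=
  sval (cid (II_full A B f)).
have liftK A B (f : hom (II A) (II B)) : fmap II (lift A B f) = f.
  by rewrite /lift; case: cid.
pose RR := qinv liftK II_inj kj jk.
exists RR; split; last first.
  by eexists; eexists; apply: (qinv_equivalence liftK II_inj kj jk).
split; last by move=> M; apply: (NP M).2.
(* The comparison map goes from [R M] to [R (I (N M))] and then projects onto [N M]. *)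
exists (fun M => pr1 (bRI addH eps_phi_iso (sval (N M))) \oc fmap R (j M)).
split=> [M|M M' f g].
  by apply: (iso_mod_pr1_R hXL addH X_inh qIX qY eps_phi_iso addR) => //; apply: svalP.
move=> /(congr1 (@fmap _ _ II _ _)).
rewrite bbI_cls [RHS]liftK => gf.
pose cg : @hom (quotMIX hXL qIX) (II (N M)) (II (N M')) :=
  cls qMIX (A := II (N M)) (B := II (N M')) (fmap I g).
pose cf : @hom (quotMIX hXL qIX) M M' := cls qMIX (A := M) (B := M') f.
(* By construction [RR] sends [cf] to the map whose image under [II] is its conjugate by the
   [cj]. *)
have : cg \oc cj M = cj M' \oc cf.
  by rewrite /cg gf -!compA kj compm1.
rewrite /= !qcomp_cls => /(@cls_full_eq G _ _ IXM qMIX M (II (N M'))) h.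
(* Naturality of the projection turns the defect into [R] of a map through [I(X)], followed by a
   projection. *)
rewrite compA -pr1_bRI_nat -!compA -compBr -!fmapM -addR; apply: factors_compl.
case: h => Z IXZ [u [v ->]].
exists (R Z); first exact: (RI_subY hXL addH eps_phi_iso).
by exists (fmap R u), (fmap R v); rewrite fmapM.
Qed.
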